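(* Let $\sigma$ be a modal signature, let $k \in \mathbb{N}$, and let $M_a$ and $N_b$ be image-finite $\sigma$-LTSs. Then $M_a$ and $N_b$ satisfy exactly the same formulas of $\mathrm{ML}^{+,k}_\Diamond$ if and only if $\hom_{\mathbb{B}}(\mathcal{T}^k_\sigma, M_a) = \hom_{\mathbb{B}}(\mathcal{T}^k_\sigma, N_b)$.
   Context: A modal signature is $\sigma = \mathrm{Prop} \cup \mathbb{A}$, where $\mathrm{Prop}$ is a finite set of unary relation symbols (proposition letters) and $\mathbb{A} = \{R_i \mid i \in I\}$ ($I$ finite) is a finite set of binary relation symbols (actions). A $\sigma$-LTS $M_a$ is a (possibly infinite) $\sigma$-structure $M$ with one distinguished element $a \in \mathrm{dom}(M)$. $M_a$ is image-finite if every state $m$ has only finitely many $n$ with $R^M(m,n)$ for some $R \in \mathbb{A}$. A homomorphism $h: T_c \to M_a$ is a map $\mathrm{dom}(T)\to\mathrm{dom}(M)$ with $h(c)=a$ such that $p^T(s)$ implies $p^M(h(s))$ and $R^T(s,t)$ implies $R^M(h(s),h(t))$ for all proposition letters $p$ and actions $R$. Over the Boolean semiring $\mathbb{B}$, $\hom_{\mathbb{B}}(T_c,M_a)$ is $1$ if some homomorphism $T_c \to M_a$ exists and $0$ otherwise; for a class $\mathcal{C}$ of finite $\sigma$-LTSs, $\hom_{\mathbb{B}}(\mathcal{C},M_a)$ is the $\mathcal{C}$-indexed family $\langle \hom_{\mathbb{B}}(T_c,M_a)\rangle_{T_c\in\mathcal{C}}$, and two such families are equal if they agree at every member of $\mathcal{C}$.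 A directed $\sigma$-path of length $\ell$ from $m$ to $n$ is a sequence $m=b_0,\dots,b_\ell=n$ with, for each $j<\ell$, $R^M(b_j,b_{j+1})$ for some $R\in\mathbb{A}$. A $\sigma$-tree is a $\sigma$-LTS $T_c$ in which every state is reached from $c$ by a unique directed $\sigma$-path; the depth of a state is the length of the shortest directed $\sigma$-path from the distinguished element to it, and the depth of the structure is the supremum of the depths of its states. $\mathcal{T}^k_\sigma$ is the class of finite $\sigma$-trees of depth at most $k$. Positive-existential modal logic $\mathrm{ML}^+_\Diamond$ has formulas $\varphi ::= p \mid \varphi\land\varphi \mid \varphi\lor\varphi \mid \Diamond_i\varphi$ ($p\in\mathrm{Prop}$, $i\in I$), with the usual semantics: $M_a\models p$ iff $p^M(a)$, and $M_a \models \Diamond_i\varphi$ iff there is $b$ with $R_i^M(a,b)$ and $M_b\models\varphi$. $\mathrm{ML}^{+,k}_\Diamond$ is the set of such formulas of modal depth (nesting depth of $\Diamond$'s) at most $k$.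
   Formalization: The formulas include verum ⊤ (the empty conjunction) besides the listed connectives, and directed paths record the actions taken, so trees have no two parallel transitions between the same states; without either change the equivalence is false. *)

(* Defs.v *)
From mathcomp Require Import all_boot.
From mathcomp Require Import boolp classical_sets cardinality.
Set Implicit Arguments.
Unset Strict Implicit.
Unset Printing Implicit Defensive.
Local Open Scope classical_set_scope.

Record signature := Signature { letter : finType; action : finType }.

Record structure (s : signature) := Structure {
  dom :> Type;
  holds : letter s -> dom -> Prop;
  trans : action s -> dom -> dom -> Prop }.

Record lts (s : signature) := Lts { str :> structure s; pt : str }.

Definition image_finite (s : signature) (M : lts s) : Prop :=
  forall m : M, finite_set [set n : M | exists i, trans i m n].

Definition is_hom (s : signature) (T M : lts s) (h : T -> M) : Prop :=
  [/\ h (pt T) = pt M,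
      forall (p : letter s) (x : T), holds p x -> holds p (h x) &
      forall (i : action s) (x y : T), trans i x y -> trans i (h x) (h y)].

(* The Boolean semiring is [bool]. *)
Definition homB (s : signature) (T M : lts s) : bool :=
  `[< exists h : T -> M, is_hom h >].

Definition homB_family (s : signature) (C : set (lts s)) (M : lts s) :
    {T : lts s | C T} -> bool :=
  fun T => homB (sval T) M.

Arguments homB_family {s} C M T.

(* A path m = b_0, ..., b_l = n is given by the list of its l steps
   (action taken, state reached).  The actions are part of the path, so that two
   parallel transitions trans i m n and trans j m n with i <> j are two distinct
   paths from m to n; in particular they cannot both occur in a tree. *)
Fixpoint is_path (s : signature) (M : structure s)
    (m : M) (p : seq (action s * M)) (n : M) : Prop :=
  if p is (i, x) :: q then trans i m x /\ is_path x q n else m = n.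

Definition is_tree (s : signature) (T : lts s) : Prop :=
  forall t : T, exists! p, is_path (pt T) p t.

Definition state_depth (s : signature) (T : lts s) (t : T) (d : nat) : Prop :=
  (exists2 p, is_path (pt T) p t & size p = d) /\
  (forall p, is_path (pt T) p t -> d <= size p).

(* The supremum of the depths of the states is at most k. *)
Definition depth_at_most (s : signature) (k : nat) (T : lts s) : Prop :=
  forall t : T, exists2 d, state_depth t d & d <= k.

Definition trees (s : signature) (k : nat) : set (lts s) :=
  [set T : lts s | [/\ finite_set [set: T], is_tree T & depth_at_most k T]].

Arguments trees : clear implicits.

(* Positive-existential modal formulas.  Verum (the empty conjunction) is
   included: without it <>_i T is not expressible, and a state with an unlabelled
   successor could not be told apart from an unlabelled state without successors. *)
Inductive form (s : signature) : Type :=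
| Top
| Letter of letter s
| And of form s & form s
| Or of form s & form s
| Dia of action s & form s.

Arguments Top {s}.

Fixpoint sat (s : signature) (M : structure s) (m : M) (phi : form s) : Prop :=
  match phi with
  | Top => True
  | Letter p => holds p m
  | And f g => sat m f /\ sat m g
  | Or f g => sat m f \/ sat m g
  | Dia i f => exists2 n : M, trans i m n & sat n f
  end.

Fixpoint modal_depth (s : signature) (phi : form s) : nat :=
  match phi with
  | Top | Letter _ => 0
  | And f g | Or f g => maxn (modal_depth f) (modal_depth g)
  | Dia _ f => (modal_depth f).+1
  end.

Definition ML_equiv (s : signature) (k : nat) (M N : lts s) : Prop :=
  forall phi : form s, modal_depth phi <= k ->
    (sat (pt M) phi <-> sat (pt N) phi).

(* Main.v *)
Require Import Defs.
From mathcomp Require Import all_boot.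
From mathcomp Require Import boolp classical_sets cardinality.

(** A finite tree of depth at most k maps homomorphically to M iff its root is
    k-step simulated by the point of M, and since the tree is finite this bounded
    simulation is defined by a positive formula of modal depth at most k.
    Conversely, a positive formula true in M only ever inspects a finite
    prefix-closed set of paths of M; this set is a finite tree that maps to M, and
    any homomorphism from it to N carries the truth of the formula to N. *)

Set Implicit Arguments.
Unset Strict Implicit.
Unset Printing Implicit Defensive.
Local Open Scope classical_set_scope.

(** * Paths and depth in trees *)

Section Paths.
Variables (s : signature) (M : structure s).

Lemma is_path_rcons (m n : M) (p : seq (action s * M)) (i : action s) (x : M) :
  is_path m (rcons p (i, x)) n <->
  exists2 y, is_path m p y & trans i y x /\ x = n.
Proof.
elim: p m => [|[j y] p IH] m /=.
  by split=> [[]|[_ <-]] //; exists m.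
split=> [[my /IH[z yz ?]]|[z [my yz] ?]]; first by exists z.
by split=> //; apply/IH; exists z.
Qed.

End Paths.

Section Tree_depth.
Variables (s : signature) (k : nat) (T : lts s).
Hypotheses (treeT : is_tree T) (depthT : depth_at_most k T).

Lemma tree_path_uniq (p q : seq (action s * T)) (t : T) :
  is_path (pt T) p t -> is_path (pt T) q t -> p = q.
Proof. by have [r [_ ru]] := treeT t => /ru <- /ru <-. Qed.

Lemma tree_path_size (p : seq (action s * T)) (t : T) :
  is_path (pt T) p t -> size p <= k.
Proof.
move=> pathp; have [d [[q pathq <-] _] qk] := depthT t.
by rewrite (tree_path_uniq pathp pathq).
Qed.

End Tree_depth.

(** * Bounded simulations, homomorphisms from trees, and definability *)

Section Bounded_simulation.
Variable s : signature.

(** The [n]-round approximant of similarity. Only the forth direction is kept, because homomorphisms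
    and positive formulas preserve truth one way. *)
Fixpoint bsim (n : nat) (T N : structure s) (t : T) (m : N) : Prop :=
  (forall p, holds p t -> holds p m) /\
  (if n is n'.+1 then
     forall i u, trans i t u -> exists2 m', trans i m m' & bsim n' u m'
   else True).

Lemma bsim_holds (n : nat) (T N : structure s) (t : T) (m : N) p :
  bsim n t m -> holds p t -> holds p m.
Proof. by case: n => [|n] [+ _]; apply. Qed.

Lemma hom_bsim (T N : lts s) (h : T -> N) (n : nat) (t : T) :
  is_hom h -> bsim n t (h t).
Proof.
move=> [_ hh htr]; elim: n t => [|n IH] t.
  by split=> // p; exact: hh.
split=> [p|i u tu]; first exact: hh.
by exists (h u); [exact: htr|exact: IH].
Qed.

(** Each state is sent to the end of a run in [N] that answers, step by step, the unique path from
    the root. Uniqueness makes the choices coherent, and the depth bound ensures that the rounds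
    never run out. *)
Lemma bsim_hom (k : nat) (T N : lts s) :
  is_tree T -> depth_at_most k T -> bsim k (pt T) (pt N) ->
  exists h : T -> N, is_hom h.
Proof.
move=> treeT depthT bsimTN.
have /choice[path pathP] t : exists p, is_path (pt T) p t.
  by have [p [pP _]] := treeT t; exists p.
pose good (a : action s * T) (m n : N) :=
  trans a.1 m n /\ bsim (k - size (path a.2)) a.2 n.
(* [f] picks an answer to a step whenever one exists; otherwise its value is junk. *)
have /choice[f fP] (x : N * (action s * T)) :
    exists n, (exists n', good x.2 x.1 n') -> good x.2 x.1 n.
  have [[n xn]|xN] := pselect (exists n, good x.2 x.1 n); first by exists n.
  by exists x.1 => /xN.
pose follow := foldl (fun m a => f (m, a)) (pt N).
have pathE p t : is_path (pt T) p t -> path t = p.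
  exact: (tree_path_uniq treeT (pathP t)).
have followP p t : is_path (pt T) p t -> bsim (k - size p) t (follow p) /\
    forall i u, trans i t u ->
      good (i, u) (follow p) (follow (rcons p (i, u))).
  have step q x i u : is_path (pt T) q x -> bsim (k - size q) x (follow q) ->
      trans i x u -> good (i, u) (follow q) (follow (rcons q (i, u))).
    move=> qx qsim xu; rewrite /follow foldl_rcons -/(follow q).
    apply: (fP (follow q, (i, u))).
    have qu : is_path (pt T) (rcons q (i, u)) u.
      by apply/is_path_rcons; exists x.
    have := tree_path_size treeT depthT qu; rewrite size_rcons => qk.
    (* The path extended to [u] still has length at most [k], so a round is left to play at [x]. *)
    move: qsim; rewrite -(prednK (_ : 0 < k - size q)) ?subn_gt0//.
    move=> [_ /(_ _ _ xu)[n xn nsim]]; exists n; split=> //=.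
    by rewrite (pathE _ _ qu) size_rcons subnS.
  suff psim : is_path (pt T) p t -> bsim (k - size p) t (follow p).
    by move=> pt_; split=> [|i u tu]; [exact: psim|apply: (step _ t); auto].
  elim/last_ind: p t => [|p [i u] IH] t; first by move=> /= <-; rewrite subn0.
  move=> put; have /is_path_rcons[x px [xu ut]] := put.
  have [_] := step _ _ _ _ px (IH _ px) xu.
  by rewrite ut in put *; rewrite /= (pathE _ _ put).
exists (fun t => follow (path t)); split=> [|p x|i x y xy].
- by rewrite (pathE [::]).
- by apply: bsim_holds; apply: (followP _ _ (pathP x)).1.
- have xyP : is_path (pt T) (rcons (path x) (i, y)) y.
    by apply/is_path_rcons; exists x.
  by rewrite (pathE _ _ xyP); have [_ /(_ _ _ xy)[]] := followP _ _ (pathP x).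
Qed.

(** The formula is chosen before the structure, so that one formula can be tested in both systems
    being compared. *)
Definition definable (k : nat) (P : forall N : structure s, N -> Prop) : Prop :=
  exists2 phi : form s, modal_depth phi <= k &
    forall (N : structure s) (n : N), sat n phi <-> P N n.

Lemma definable_and k (P Q : forall N : structure s, N -> Prop) :
  definable k P -> definable k Q -> definable k (fun N n => P N n /\ Q N n).
Proof.
move=> [f fk fP] [g gk gQ]; exists (And f g); first by rewrite /= geq_max fk.
by move=> N n /=; rewrite fP gQ.
Qed.

Lemma definable_imply k (A : Prop) (P : forall N : structure s, N -> Prop) :
  definable k P -> definable k (fun N n => A -> P N n).
Proof.
move=> [f fk fP]; have [a|na] := pselect A.
  by exists f => // N n; rewrite fP; split=> [//|/(_ a)].
by exists Top => // N n; split=> // _ /na.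
Qed.

Lemma definable_forall k (U : Type) (Q : U -> forall N : structure s, N -> Prop) :
  finite_set [set: U] -> (forall u, definable k (Q u)) ->
  definable k (fun N n => forall u, Q u N n).
Proof.
move=> /(@finite_seqP {classic U})[r rE] Qdef.
suff [f fk fP] : definable k (fun N n => forall u : {classic U}, u \in r -> Q u N n).
  exists f => // N n; rewrite fP; split=> [Qr u|Qu u _]; last exact: Qu.
  by apply: Qr; have : [set: {classic U}] u by []; rewrite rE.
elim: r {rE} => [|v r [f fk fP]]; first by exists Top.
have [g gk gP] := Qdef v; exists (And g f); first by rewrite /= geq_max gk.
move=> N n /=; rewrite fP gP; split=> [[Qv Qr] u|Qvr].
  by rewrite inE => /predU1P[->|/Qr].
by split=> [|u ur]; apply: Qvr; rewrite inE ?eqxx ?ur ?orbT.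
Qed.

(** This is the characteristic formula of [t]: a conjunction of its letters and of one diamond per
    outgoing transition, finite because the letters, the actions and [T] are. *)
Lemma definable_bsim (T : structure s) (k : nat) (t : T) :
  finite_set [set: T] -> definable k (fun N n => bsim k t n).
Proof.
move=> finT; have lettersP k' u :
    definable k' (fun N n => forall p, holds p (u : T) -> holds p n).
  apply: definable_forall => // p; apply: definable_imply.
  by exists (Letter p).
elim: k t => [|k IH] t; apply: definable_and => //; first by exists Top.
apply: definable_forall => // i; apply: definable_forall => // u.
apply: definable_imply; have [f fk fP] := IH u; exists (Dia i f) => // N n /=.
by split=> -[m nm /fP]; exists m.
Qed.

End Bounded_simulation.

(** * Finite trees of paths witnessing positive formulas *)

Section Path_tree.
Variables (s : signature) (M : lts s).

(* Steps carry the code of an action in nat: the actions live in the universe of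
   finType, which lies strictly above that of the states of a structure, so they
   may not occur in the states of a tree. *)
Definition endpoint (m : M) (p : seq (nat * M)) : M := last m (unzip2 p).

Lemma endpoint_rcons (m : M) (p : seq (nat * M)) (a : nat * M) :
  endpoint m (rcons p a) = a.2.
Proof. by rewrite /endpoint /unzip2 map_rcons last_rcons. Qed.

Definition path_closed (m : M) (X : set (seq (nat * M))) : Prop :=
  forall p a, X (rcons p a) ->
    X p /\ exists2 i : action s, a.1 = pickle i & trans i (endpoint m p) a.2.

Section Construction.
Variable X : set (seq (nat * M)).
Hypotheses (X0 : X [::]) (Xclosed : path_closed (pt M) X).

(** A fragment of the unravelling of [M] at its point. *)
Definition path_structure : structure s :=
  @Structure s {p | X p} (fun l t => holds l (endpoint (pt M) (sval t)))
    (fun i t u => exists x, sval u = rcons (sval t) (pickle i, x)).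

Definition path_tree : lts s := @Lts s path_structure (exist _ [::] X0).

Lemma path_tree_path_size (t : path_tree) p :
  is_path (pt path_tree) p t -> size p = size (sval t).
Proof.
elim/last_ind: p t => [|p [i u] IH] t; first by move=> /= <-.
move=> /is_path_rcons[y /IH py [[x ux] <-]].
by rewrite ux !size_rcons py.
Qed.

(** A state is itself a list of steps, so its predecessor and incoming action are read off its last
    entry; closure under prefixes gives existence of the path. *)
Lemma path_tree_is_tree : is_tree path_tree.
Proof.
move=> t; suff [p pP] : exists p, is_path (pt path_tree) p t.
  exists p; split=> // q; elim/last_ind: p t q pP => [|p [i u] IH] t q pP qP.
    apply/esym/size0nil.
    by rewrite (path_tree_path_size qP) -(path_tree_path_size pP).
  have := path_tree_path_size qP; rewrite -(path_tree_path_size pP) size_rcons.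
  case/lastP: q qP => [//|q [j v]] /is_path_rcons[z qz [[x' vx'] vt]] _.
  have /is_path_rcons[y py [[x ux] ut]] := pP.
  move: vx'; rewrite vt -ut ux => /rcons_inj[yz /(pcan_inj pickleK) ij _].
  have {}yz : y = z by apply: eq_sig_hprop yz => *; exact: Prop_irrelevance.
  by rewrite ij (IH y q py) // yz.
case: t => p; elim/last_ind: p => [|p [c x] IH] Xp.
  by exists [::]; apply: eq_exist.
have [Xp' [i /= ci _]] := Xclosed Xp; have [q qP] := IH Xp'.
exists (rcons q (i, exist _ _ Xp)); apply/is_path_rcons.
by exists (exist _ _ Xp') => //; split=> //; exists x; rewrite /= ci.
Qed.

Lemma path_tree_trees k :
  finite_set X -> (forall p, X p -> size p <= k) -> trees s k path_tree.
Proof.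
move=> finX Xk; split; first 1 last.
- exact: path_tree_is_tree.
- move=> t; exists (size (sval t)); last exact/Xk/(svalP t).
  split=> [|p /path_tree_path_size->//].
  have [p [pt_ _]] := path_tree_is_tree t.
  by exists p => //; exact: path_tree_path_size.
(* The states are the image of the finite set [X]; the default outside [X] is harmless. *)
pose toT p : path_tree :=
  if pselect (X p) is left Xp then exist _ p Xp else pt path_tree.
rewrite (_ : [set: path_tree] = toT @` X); first exact: finite_image.
apply/seteqP; split=> // -[p Xp] _; exists p => //; rewrite /toT.
by case: pselect => // Xp'; apply: eq_exist.
Qed.

Lemma path_tree_hom : is_hom (fun t : path_tree => endpoint (pt M) (sval t)).
Proof.
split=> // i t u [x ux]; have := svalP u.
rewrite ux => /Xclosed[_ [j /(pcan_inj pickleK) <-]].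
by rewrite endpoint_rcons.
Qed.

End Construction.

(* Homomorphisms are taken here as total functions on lists, constrained only on
   X, so that the induction needs no subtypes. *)
Lemma sat_finite_paths (m : M) (phi : form s) : sat m phi ->
  exists X : set (seq (nat * M)),
  [/\ finite_set X, X [::], path_closed m X,
      forall p, X p -> size p <= modal_depth phi &
      forall (N : structure s) (h : seq (nat * M) -> N),
        (forall l p, X p -> holds l (endpoint m p) -> holds l (h p)) ->
        (forall i x p, X (rcons p (pickle i, x)) ->
          trans i (h p) (h (rcons p (pickle i, x)))) ->
        sat (h [::]) phi].
Proof.
have closed0 m' : path_closed m' [set [::]] by case.
elim: phi m =>
  [m _|l m ml|f IHf g IHg m [mf mg]|f IHf g IHg m []|i f IH m [n mn nf]].
- by exists [set [::]]; split=> // p ->.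
- by exists [set [::]]; split=> // [p ->//|N h hl _]; exact: hl.
- have [X [finX X0 Xc Xk Xh]] := IHf _ mf.
  have [Y [finY Y0 Yc Yk Yh]] := IHg _ mg.
  exists (X `|` Y); split=> [||p a [/Xc|/Yc] [pXY ai]|p|N h hl ht].
  + by rewrite finite_setU.
  + by left.
  + by split=> //; left.
  + by split=> //; right.
  + by case=> [/Xk|/Yk] pk; rewrite /= leq_max pk ?orbT.
  + split; [apply: Xh => [l p Xp|i x p Xp]|apply: Yh => [l p Yp|i x p Yp]].
    * by apply: hl; left.
    * by apply: ht; left.
    * by apply: hl; right.
    * by apply: ht; right.
- move=> /IHf[X [finX X0 Xc Xk Xh]]; exists X; split=> // [p /Xk pk|N h hl ht].
    by rewrite /= leq_max pk.
  by left; apply: Xh.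
- move=> /IHg[X [finX X0 Xc Xk Xh]]; exists X; split=> // [p /Xk pk|N h hl ht].
    by rewrite /= leq_max pk orbT.
  by right; apply: Xh.
- have [X [finX X0 Xc Xk Xh]] := IH _ nf.
  (* The paths explored from [n] are prefixed by the step to [n], and the empty path is restored as
     root. *)
  exists ([set [::]] `|` [set (pickle i, n) :: p | p in X]); split.
  + by rewrite finite_setU; split=> //; exact: finite_image.
  + by left.
  + move=> [|b p] a [//|[q Xq [<- qE]]].
      by split; [left|exists i].
    by have [|Xp ai] := Xc p a; [rewrite -qE|split=> //; right; exists p].
  + by move=> p [->//|[q /Xk qk <-]].
  + move=> N h hl ht; exists (h [:: (pickle i, n)]).
      by apply: (ht i n [::]); right; exists [::].
    apply: (Xh _ (fun p => h ((pickle i, n) :: p))) => [l p Xp hp|j x p Xp].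
      by apply: hl => //; right; exists p.
    apply: (ht j x ((pickle i, n) :: p)); right.
    by exists (rcons p (pickle j, x)).
Qed.

(** The tree records one way of making [phi] true, with disjuncts and successors already chosen. *)
Lemma sat_tree (phi : form s) k : sat (pt M) phi -> modal_depth phi <= k ->
  exists T : lts s, [/\ trees s k T, exists h : T -> M, is_hom h &
    forall (N : lts s) (h : T -> N), is_hom h -> sat (pt N) phi].
Proof.
move=> /sat_finite_paths[X [finX X0 Xc Xk Xh]] phik.
exists (path_tree X0); split.
- by apply: path_tree_trees => // p /Xk pk; exact: leq_trans phik.
- by eexists; exact: path_tree_hom.
move=> N h [hpt hl ht].
(* Extension of [h] to all lists; the value outside [X] is arbitrary. *)
pose h' p := if pselect (X p) is left Xp then h (exist _ p Xp) else pt N.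
have h'E p (Xp : X p) : h' p = h (exist _ p Xp).
  by rewrite /h'; case: pselect => // Xp'; congr h; apply: eq_exist.
have <- : h' [::] = pt N by rewrite h'E -hpt.
apply: Xh => [l p Xp lp|i x p Xpx].
  by rewrite (h'E _ Xp); apply: hl.
have [Xp _] := Xc _ _ Xpx.
by rewrite (h'E _ Xpx) (h'E _ Xp); apply: ht; exists x.
Qed.

End Path_tree.

Theorem theorem3p2 (s : signature) (k : nat) (M N : lts s)
    (hM : image_finite M) (hN : image_finite N) :
  ML_equiv k M N <->
  (homB_family (trees s k) M =1 homB_family (trees s k) N).
Proof.
have hom_transfer (A B : lts s) (T : lts s) : trees s k T -> ML_equiv k A B ->
    (exists h : T -> A, is_hom h) -> exists h : T -> B, is_hom h.
  move=> [finT treeT depthT] AB [h hh]; apply: bsim_hom treeT depthT _.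
  (* The characteristic formula of the root of [T] holds in [A] by the given homomorphism, hence in
     [B]. *)
  have [f fk fP] := definable_bsim k (pt T) finT.
  apply/fP/AB => //; apply/fP; have [<- _ _] := hh; exact: hom_bsim.
have sat_transfer (A B : lts s) phi : modal_depth phi <= k ->
    homB_family (trees s k) A =1 homB_family (trees s k) B ->
    sat (pt A) phi -> sat (pt B) phi.
  move=> phik AB Aphi; have [T [treeT hA hB]] := sat_tree Aphi phik.
  have := AB (exist _ T treeT); rewrite /homB_family /homB /=.
  by rewrite (asboolT hA) => /esym/asboolP[h]; exact: hB.
split=> [MN [T treeT]|MN phi phik].
  apply: asbool_equiv_eq => /=; split; apply: hom_transfer => //.
  by move=> phi phik; split=> /MN; apply.
by split; apply: sat_transfer => // T; rewrite MN.
Qed.
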